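(* Let $\kappa$ be a cardinal number. Then there exist a lattice $L$ and a maximal congruence $\mu$ of $L$ with $|L/\mu|=\kappa$ if and only if $\kappa=2$ or $\kappa\ge5$.
   Context: Lattices are non-empty. A maximal congruence of $L$ is a maximal element, with respect to inclusion, of the set of congruences of $L$ different from $L^2$. *)

(* Defs.v *)
From mathcomp Require Import all_boot all_order.
From mathcomp Require Import boolp classical_sets functions cardinality.

Set Implicit Arguments.
Unset Strict Implicit.
Unset Printing Implicit Defensive.

Local Open Scope classical_set_scope.

(* Binary relations on L are subsets of L * L, so that inclusion of relations
   is `<=` and the full relation L^2 is setT. *)
Record congruence (d : Order.disp_t) (L : latticeType d) (theta : set (L * L))
    : Prop := Congruence {
  congr_refl : forall x, theta (x, x);
  congr_sym : forall x y, theta (x, y) -> theta (y, x);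
  congr_trans : forall x y z, theta (x, y) -> theta (y, z) -> theta (x, z);
  congr_meet : forall x x' y y', theta (x, x') -> theta (y, y') ->
    theta (Order.meet x y, Order.meet x' y');
  congr_join : forall x x' y y', theta (x, x') -> theta (y, y') ->
    theta (Order.join x y, Order.join x' y')
}.

Definition proper_congruence (d : Order.disp_t) (L : latticeType d)
    (theta : set (L * L)) : Prop :=
  congruence theta /\ theta <> setT.

Definition maximal_congruence (d : Order.disp_t) (L : latticeType d)
    (mu : set (L * L)) : Prop :=
  proper_congruence mu /\
  forall theta : set (L * L),
    proper_congruence theta -> mu `<=` theta -> theta = mu.

Definition quotient_set (T : Type) (theta : set (T * T)) : set (set T) :=
  [set [set y | theta (x, y)] | x in [set: T]].

(* Main.v *)
Require Import Defs.
From HB Require Import structures.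
From mathcomp Require Import all_boot all_order.
From mathcomp Require Import boolp classical_sets functions cardinality.

(* If L/mu is simple and some lattice homomorphism from L/mu onto the two-element
   chain exists, then its kernel is trivial and |L/mu| = 2.  When L/mu has at most
   four elements it has a least element 0, and such a homomorphism exists: either
   no two nonzero elements meet in 0, and x |-> (x <> 0) works, or a /\ b = 0 with
   a, b nonzero, in which case L/mu = {0, a, b, a \/ b} and x |-> (b <= x) works.
   Conversely, the bounded lattice in which all elements other than the bounds are
   atoms and coatoms is simple as soon as the number of atoms is not 1 or 2. *)

Local Open Scope classical_set_scope.
Local Open Scope card_scope.

Import Order.TTheory.
Local Open Scope order_scope.

(** * Quotients with fewer than five classes *)

Lemma card_seq (T : eqType) (s : seq T) : uniq s -> [set` s] #= `I_(size s).
Proof.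
move=> us; apply: card_esym; case: s us => [|x0 s] us.
  by rewrite (_ : [set` [::]] = set0) ?II0 ?card_eq00 // -subset0 => x.
have -> : [set` x0 :: s] = [set nth x0 (x0 :: s) i | i in `I_(size (x0 :: s))].
  apply/seteqP; split=> [x /= xs|_ [i /= ilt <-]]; last exact: mem_nth.
  by exists (index x (x0 :: s)); [rewrite -index_mem in xs|exact: nth_index].
apply/card_esym/inj_card_eq => i j /set_mem il /set_mem jl eq_ij.
by apply/eqP; rewrite -(nth_uniq x0 (s := x0 :: s) il jl us) eq_ij.
Qed.

Section Quotient.
Context (d : Order.disp_t) (L : latticeType d) (mu : set (L * L)).
Implicit Types (x y : L) (P : L -> Prop).

Let cl x : set L := [set y | mu (x, y)].

Lemma classP x y : congruence mu -> cl x = cl y <-> mu (x, y).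
Proof.
case=> re sy tr _ _; split=> [e|xy].
  have : cl y y by exact: re.
  by rewrite -e.
apply/seteqP; split=> z /= zz; [apply: tr (sy _ _ xy) zz|exact: tr xy zz].
Qed.

Lemma card_le_quotient (s : seq L) : congruence mu ->
  pairwise (fun x y => ~~ `[< mu (x, y) >]) s -> `I_(size s) #<= quotient_set mu.
Proof.
move=> cmu ps.
have us : uniq [seq cl x | x <- s].
  rewrite uniq_pairwise pairwise_map; apply: sub_pairwise ps => x y /= /asboolPn h.
  by apply/eqP => /(classP _ _ cmu).
rewrite -(size_map cl s) -(card_le_eql (card_seq _ _ us)).
by apply: subset_card_le => _ /= /mapP[x _ ->]; exists x.
Qed.

(** The hypotheses make [P] a homomorphism to the two-element chain of truth values, and the
    relation is its kernel. *)
Lemma prime_congruence P :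
  (forall x y, P (x `&` y) <-> P x /\ P y) ->
  (forall x y, P (x `|` y) <-> P x \/ P y) ->
  congruence [set p : L * L | P p.1 <-> P p.2].
Proof.
move=> PI PU; split=> /= [//|x y -> //|x y z -> -> //|x x' y y' ? ?|x x' y y' ? ?].
  by rewrite !PI; tauto.
by rewrite !PU; tauto.
Qed.

(** The kernel of [P] contains [mu] and separates [u] from [v], so it equals [mu] by maximality; the
    classes are then the two fibres of [P]. *)
Lemma quotient_card2 P (u v : L) : maximal_congruence mu ->
  (forall x y, mu (x, y) -> P x -> P y) ->
  (forall x y, P (x `&` y) <-> P x /\ P y) ->
  (forall x y, P (x `|` y) <-> P x \/ P y) ->
  P u -> ~ P v -> quotient_set mu #= `I_2.
Proof.
move=> [[cmu _] mx] Pmu PI PU Pu Pv.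
have muE : [set p : L * L | P p.1 <-> P p.2] = mu.
  apply: mx => [|[x y] /= xy]; last first.
    by split; apply: Pmu => //; apply: congr_sym.
  split; first exact: prime_congruence.
  by move=> /seteqP[_ /(_ (u, v) I)] /= [/(_ Pu)].
have usl : uniq [:: cl u; cl v].
  rewrite /= andbT inE; apply/eqP => /(classP _ _ cmu); rewrite -muE /=; tauto.
rewrite (_ : quotient_set mu = [set` [:: cl u; cl v]]); first exact: card_seq usl.
apply/seteqP; split=> [_ [x _ <-]|X] /=; last first.
  by rewrite !inE => /orP[]/eqP ->; [exists u|exists v].
rewrite !inE; apply/orP.
have [Px|Px] := pselect (P x); [left|right]; apply/eqP/(classP _ _ cmu);
  by rewrite -muE /=; tauto.
Qed.

(** The meet of one representative of each class lies in the least class. *)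
Lemma finite_quotient_bottom : [set: L] !=set0 -> congruence mu ->
  finite_set (quotient_set mu) -> exists z, forall x, mu (z `&` x, z).
Proof.
move=> [x0 _] cmu /finite_seqP[S SE].
(* [S] lists the classes and [s] picks a member of each; [x0] is the default value of [xget]. *)
pose s := [seq xget x0 [set x | X = cl x] | X <- S].
have sP x : exists2 y, y \in s & mu (x, y).
  have : quotient_set mu (cl x) by exists x.
  rewrite SE => /= xS; exists (xget x0 [set y | cl x = cl y]); first exact: map_f.
  by apply/(classP _ _ cmu); apply: (xgetPex x0 (P := [set y | cl x = cl y])); exists x.
have le_s y : y \in s -> foldr Order.meet x0 s <= y.
  elim: s {sP} => //= w s ih; rewrite inE => /orP[/eqP->|/ih]; first exact: leIl.
  by apply: le_trans; exact: leIr.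
exists (foldr Order.meet x0 s) => x; have [y ys xy] := sP x.
rewrite -[X in mu (_, X)](meet_idPl (le_s y ys)).
by apply: congr_meet xy; last exact: congr_refl.
Qed.

(** The quotient lattice is never formed: its order and operations are handled in [L] modulo [mu],
    with [z] representing 0. *)
Lemma small_quotient_card2 : [set: L] !=set0 -> maximal_congruence mu ->
  ~ (`I_5 #<= quotient_set mu) -> quotient_set mu #= `I_2.
Proof.
move=> L0 mmu n5; have [[cmu muT] _] := mmu.
have re := congr_refl cmu; have sy := congr_sym cmu; have tr := congr_trans cmu.
have me := congr_meet cmu; have jo := congr_join cmu.
have fin : finite_set (quotient_set mu).
  apply: contrapT => /infiniteP inf; apply: n5.
  by apply: card_le_trans inf; exact: subset_card_le.
have [z zP] := finite_quotient_bottom L0 cmu fin.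
have joinz x y : mu (x `|` y, z) -> mu (x, z).
  move=> h; have := me _ _ _ _ (re x) h; rewrite joinKI => h'.
  by apply: tr h' _; rewrite meetC.
have joinzz x y : mu (x, z) -> mu (y, z) -> mu (x `|` y, z).
  by move=> hx hy; have := jo _ _ _ _ hx hy; rewrite joinxx.
have [[a [b [az bz abz]]]|nz] :=
    pselect (exists a b, [/\ ~ mu (a, z), ~ mu (b, z) & mu (a `&` b, z)]); last first.
  have [u uz] : exists u, ~ mu (u, z).
    apply/existsNP => h; apply: muT; rewrite -subTset => -[x y] _.
    exact: tr (h x) (sy _ _ (h y)).
  apply: (quotient_card2 (fun x => ~ mu (x, z)) u z) => //.
  - by move=> x y xy nx yz; apply: nx; exact: tr yz.
  - move=> x y; split=> [h|[hx hy] h]; last by apply: nz; exists x, y.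
    split=> h'; apply: h.
      by apply: tr (zP y); apply: me.
    by rewrite meetC; apply: tr (zP x); apply: me.
  - move=> x y; split=> [h|[] h h']; last 2 first.
    + by apply: h; apply: joinz h'.
    + by apply: h; apply: (joinz y x); rewrite joinC.
    have [hx|] := pselect (mu (x, z)); last by left.
    by right=> hy; apply: h; exact: joinzz.
(* [P x] says that b <= x holds in L/mu. *)
pose P x := mu (b `&` x, b).
have Pmu x y : mu (x, y) -> P x -> P y.
  by move=> xy; apply: tr; apply: me => //; exact: sy.
have nPz : ~ P z by rewrite /P meetC => h; apply: bz; exact: tr (sy _ _ h) (zP b).
have nPa : ~ P a by rewrite /P meetC => h; apply: bz; exact: tr (sy _ _ h) abz.
have Pb : P b by rewrite /P meetxx.
(* Joining both sides of b /\ x ~ b with b /\ y gives b /\ y ~ b. *)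
have PS x y : x <= y -> P x -> P y.
  move=> xy Px; have := jo _ _ _ _ Px (re (b `&` y)).
  rewrite (join_idPl (leIl b y)) (join_idPr (leI2 (lexx b) xy)).
  exact.
(* With [az] and [bz], the next four facts make z, a, b and a \/ b pairwise incongruent. *)
have abza : ~ mu (a `|` b, a).
  by move=> h; apply: nPa; apply: Pmu h _; exact: PS (leUr _ _) Pb.
have abzz : ~ mu (a `|` b, z) by move=> /joinz.
have nab : ~ mu (a, b) by move=> h; apply: nPa; apply: Pmu (sy _ _ h) Pb.
have nabb : ~ mu (b, a `|` b).
  move=> h; apply: az; apply: tr abz; rewrite -{1}(joinKI b a).
  by apply: me (re a) _; exact: sy.
(* Otherwise z, a, b, a `|` b and x are pairwise incongruent. *)
have nPE x : ~ P x -> mu (x, z) \/ mu (x, a).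
  move=> nPx; apply: contrapT => /not_orP[xz xa]; apply: n5.
  apply: (card_le_quotient [:: x; z; a; b; a `|` b]) => //=.
  have xb : ~ mu (x, b) by move=> h; apply: nPx; apply: Pmu (sy _ _ h) Pb.
  have xab : ~ mu (x, a `|` b).
    by move=> h; apply: nPx; apply: Pmu (sy _ _ h) _; exact: PS (leUr _ _) Pb.
  have zP' y : ~ mu (y, z) -> ~ mu (z, y) by move=> h /sy.
  have aab : ~ mu (a, a `|` b) by move=> /sy.
  by do !(apply/andP; split) => //; apply/asboolPn => //; exact: zP'.
apply: (quotient_card2 P b z) => //.
- move=> x y; split=> [h|[Px Py]].
    by split; [apply: PS h; exact: leIl|apply: PS h; exact: leIr].
  by rewrite /P meetA; apply: tr Py; apply: me.
- move=> x y; split=> [h|[]]; last 2 first.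
  + by apply: PS; exact: leUl.
  + by apply: PS; exact: leUr.
  (* If [P] fails at x and y, both lie below a modulo [mu], hence so does x \/ y; then P (x \/ y)
     would force P a. *)
  apply: contrapT => /not_orP[/nPE xE /nPE yE].
  have leaE w : mu (w, z) \/ mu (w, a) -> mu (w `|` a, a).
    case=> wE; last by have := jo _ _ _ _ wE (re a); rewrite joinxx.
    apply: tr (jo _ _ _ _ wE (re a)) _.
    by have := jo _ _ _ _ (sy _ _ (zP a)) (re a); rewrite meetUK.
  apply: nPa; apply: (Pmu _ _ (leaE x xE)); apply: (Pmu _ _ (jo _ _ _ _ (re x) (leaE y yE))).
  by apply: PS h; rewrite joinA; exact: leUl.
Qed.

End Quotient.

(** * The lattice of two bounds and pairwise incomparable atoms *)

(** The bounds and the proof that they differ are recorded in the type, so that each choice of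
    bounds carries its own order instance. [{classic K}] supplies decidable equality on an arbitrary
    type. *)
Definition flat_lattice (K : Type) (bot top : {classic K}) of bot != top : Type :=
  {classic K}.

Section FlatLattice.
Context (K : Type) (bot top : {classic K}) (bt : bot != top).
Local Notation M := (flat_lattice _ _ _ bt).

HB.instance Definition _ := Choice.on M.

Definition flat_le (x y : M) := [|| x == y, x == bot | y == top].
Definition flat_meet (x y : M) : M :=
  if flat_le x y then x else if flat_le y x then y else bot.
Definition flat_join (x y : M) : M :=
  if flat_le x y then y else if flat_le y x then x else top.

Lemma flat_le_refl : reflexive flat_le.
Proof. by move=> x; rewrite /flat_le eqxx. Qed.

Lemma flat_le_bot (x : M) : flat_le bot x.
Proof. by rewrite /flat_le eqxx orbT. Qed.

Lemma flat_le_top (x : M) : flat_le x top.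
Proof. by rewrite /flat_le eqxx !orbT. Qed.

Lemma flat_le_anti : antisymmetric flat_le.
Proof.
move=> x y /andP[/or3P[/eqP//|/eqP xb|/eqP yt] /or3P[/eqP//|/eqP yb|/eqP xt]].
- exact: etrans xb (esym yb).
- by case/eqP: bt; exact: etrans (esym xb) xt.
- by case/eqP: bt; exact: etrans (esym yb) yt.
- exact: etrans xt (esym yt).
Qed.

Lemma flat_le_trans : transitive flat_le.
Proof.
move=> y x z; rewrite /flat_le.
case/or3P=> [/eqP->//|->|/eqP yt /or3P[/eqP<-|/eqP yb|->]]; rewrite ?orbT //.
  by rewrite yt eqxx !orbT.
by case/eqP: bt; exact: etrans (esym yb) yt.
Qed.

Fact flat_display : Order.disp_t. Proof. exact: Order.Disp tt tt. Qed.

HB.instance Definition _ := Order.Le_isPOrder.Build flat_display M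
  flat_le_refl flat_le_anti flat_le_trans.

Lemma flat_meetP (x y z : M) : (x <= flat_meet y z) = (x <= y) && (x <= z).
Proof.
rewrite /Order.le /= /flat_meet; case: ifP => [yz|nyz].
  by apply/idP/andP => [xy|[]//]; split=> //; exact: flat_le_trans yz.
case: ifP => [zy|nzy].
  by apply/idP/andP => [xz|[]//]; split=> //; exact: flat_le_trans zy.
(* Here y and z are incomparable, so only the bottom lies below both. *)
apply/idP/andP => [/or3P[/eqP->|/eqP->|/eqP/esym tb]|[]]; last 1 first.
- move=> /or3P[/eqP->|/eqP->|/eqP yt]; rewrite ?nyz ?flat_le_bot //.
  by move: nzy; rewrite yt flat_le_top.
- by rewrite !flat_le_bot.
- by rewrite !flat_le_bot.
- by case/eqP: bt.
Qed.

Lemma flat_joinP (x y z : M) : (flat_join x y <= z) = (x <= z) && (y <= z).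
Proof.
rewrite /Order.le /= /flat_join; case: ifP => [xy|nxy].
  by apply/idP/andP => [yz|[]//]; split=> //; exact: flat_le_trans yz.
case: ifP => [yx|nyx].
  by apply/idP/andP => [xz|[]//]; split=> //; exact: flat_le_trans xz.
apply/idP/andP => [/or3P[/eqP<-|/eqP tb|/eqP->]|[]]; last 1 first.
- move=> /or3P[/eqP<-|/eqP xb|/eqP->]; rewrite ?nyx ?flat_le_top //.
  by move: nxy; rewrite xb flat_le_bot.
- by rewrite !flat_le_top.
- by case/eqP: bt.
- by rewrite !flat_le_top.
Qed.

HB.instance Definition _ := Order.POrder_MeetJoin_isLattice.Build flat_display M
  flat_meetP flat_joinP.

Let b0 : M := bot.
Let t0 : M := top.

Lemma flat_bot (x : M) : b0 <= x.
Proof. exact: flat_le_bot. Qed.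

Lemma flat_top (x : M) : x <= t0.
Proof. exact: flat_le_top. Qed.

Definition atom (x : M) := (x != b0) && (x != t0).

Lemma flat_atoms (x y : M) : atom x -> atom y -> x != y ->
  x `&` y = b0 /\ x `|` y = t0.
Proof.
move=> /andP[xb xt] /andP[yb yt] xy.
rewrite /Order.meet /Order.join /= /flat_meet /flat_join /flat_le -/b0 -/t0.
by rewrite [y == x]eq_sym (negPf xy) (negPf xb) (negPf xt) (negPf yb) (negPf yt).
Qed.

(* For distinct atoms a, b, c, collapsing a and 0 collapses b and 1, hence 0 and c,
   hence a and 1. *)
Lemma flat_lattice_simple (theta : set (M * M)) :
  (forall a : M, atom a -> exists b c : M,
    [/\ atom b, atom c, a != b, a != c & b != c]) ->
  congruence theta -> theta <> setT -> theta = [set p | p.1 = p.2].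
Proof.
move=> atoms cth thT.
have re := congr_refl cth; have sy := congr_sym cth; have tr := congr_trans cth.
have me := congr_meet cth; have jo := congr_join cth.
have nbt : ~ theta (b0, t0).
  move=> bt'; apply: thT; rewrite -subTset => -[x y] _.
  have bz z : theta (b0, z).
    have := me _ _ _ _ bt' (re z).
    by rewrite (meet_idPl (flat_bot z)) (meet_idPr (flat_top z)).
  exact: tr (sy _ _ (bz x)) (bz y).
(* For distinct atoms a, b, c, collapsing a and 0 collapses 1 and b, hence c and 0,
   hence 1 and a. *)
have na a : atom a -> ~ theta (b0, a).
  move=> Aa h; have [b [c [Ab Ac ab ac bc]]] := atoms a Aa.
  have bE : theta (b, t0).
    have := jo _ _ _ _ (re b) h.
    by rewrite (join_idPl (flat_bot b)) joinC (flat_atoms _ _ Aa Ab ab).2.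
  have cE : theta (b0, c).
    have := me _ _ _ _ bE (re c).
    by rewrite (flat_atoms _ _ Ab Ac bc).1 (meet_idPr (flat_top c)).
  have := jo _ _ _ _ (re a) cE.
  rewrite (join_idPl (flat_bot a)) (flat_atoms _ _ Aa Ac ac).2 => at'.
  exact: nbt (tr _ _ _ h at').
have nbl x : x != b0 -> ~ theta (b0, x).
  move=> xb h; have [xt|xt] := eqVneq x t0; first by apply: nbt; rewrite -xt.
  by apply: na h; rewrite /atom xb.
(* If x is not 0, then x is an atom and y = 1; meeting with another atom b collapses 0 and b. *)
have nlt x y : x < y -> ~ theta (x, y).
  move=> xy h; have [xb|xb] := eqVneq x b0.
    by apply: (nbl y); rewrite -xb // (gt_eqF xy).
  have yt : y = t0.
    move: (ltW xy); rewrite /Order.le /= /flat_le -/b0 -/t0 (negPf xb) (lt_eqF xy).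
    by move/eqP.
  have Ax : atom x by rewrite /atom xb -yt (lt_eqF xy).
  have [b [_ [Ab _ nxb _ _]]] := atoms x Ax.
  have := me _ _ _ _ h (re b).
  rewrite yt (flat_atoms _ _ Ax Ab nxb).1 (meet_idPr (flat_top b)); apply: nbl.
  by case/andP: Ab.
apply/seteqP; split=> [[x y] /= xy|[x y] /= -> //].
apply: contrapT => /eqP nxy.
(* Collapsing x and y collapses x /\ y and x \/ y, which are strictly comparable when x and y
   differ. *)
apply: (nlt (x `&` y) (x `|` y)).
  rewrite lt_def (le_trans (leIl x y) (leUl x y)) andbT.
  apply/eqP => e; move/eqP: nxy; apply; apply: le_anti.
  apply/andP; split; first by apply: le_trans (leUl x y) _; rewrite e leIr.
  by apply: le_trans (leUr y x) _; rewrite e leIl.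
have := me _ _ _ _ xy (re y); rewrite meetxx => h1.
have := jo _ _ _ _ xy (re y); rewrite joinxx => /sy h2.
exact: tr h1 h2.
Qed.

Lemma flat_lattice_diagonal :
  (forall a : M, atom a -> exists b c : M,
    [/\ atom b, atom c, a != b, a != c & b != c]) ->
  maximal_congruence [set p : M * M | p.1 = p.2].
Proof.
move=> atoms; split; last first.
  by move=> theta [cth thT] _; exact: flat_lattice_simple.
split; last by move=> /seteqP[_ /(_ (b0, t0) I)] /= /eqP; rewrite (negPf bt).
by split=> /= [//|//|x y z -> //|x x' y y' -> -> //|x x' y y' -> -> //].
Qed.

End FlatLattice.

(** * The possible cardinalities of L/mu *)

Lemma card_quotient_diagonal (T : Type) :
  quotient_set [set p : T * T | p.1 = p.2] #= [set: T].
Proof.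
apply: inj_card_eq => x y _ _ e.
have : [set z | x = z] x by [].
by rewrite [X in X x]e.
Qed.

(** The cardinal is that of an arbitrary type [K]. Non-emptiness of [L] is stated explicitly because
    a [latticeType] may have an empty carrier. *)
Theorem proposition7p1 (K : Type) :
  (exists (d : Order.disp_t) (L : latticeType d) (mu : set (L * L)),
      [/\ [set: L] !=set0, maximal_congruence mu &
          quotient_set mu #= [set: K]])
  <-> ([set: K] #= `I_2 \/ `I_5 #<= [set: K]).
Proof.
split=> [[d [L [mu [L0 mmu muK]]]]|hK].
  have [K5|K5] := pselect (`I_5 #<= [set: K]); [by right|left].
  rewrite -(card_eql muK); apply: small_quotient_card2 => // mu5.
  by apply: K5; rewrite -(card_le_eqr muK).
have [bot [top [bt atoms]]] : exists (bot top : {classic K}) (bt : bot != top),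
    forall a, atom K bot top bt a -> exists b c, [/\ atom K bot top bt b,
      atom K bot top bt c, a != b, a != c & b != c].
  (* With two elements the bounds exhaust [K], so the condition on atoms is vacuous. *)
  case: hK => [/card_set_bijP[f [ffun finj fsurj]]|/pcard_surjP[g gsurj]].
    have [x0 _ f0] := fsurj 0 isT; have [x1 _ f1] := fsurj 1 isT.
    have bt : x0 != x1 :> {classic K} by apply/eqP => e; move: f1; rewrite -e f0.
    exists x0, x1, bt => a /andP[/eqP a0 /eqP a1].
    have : f a = 0 \/ f a = 1.
      have : (f a < 2)%N by exact: ffun.
      by case: (f a) => [|[|//]] _; [left|right].
    case=> fa; first by case: a0; apply: finj; rewrite ?inE // fa f0.
    by case: a1; apply: finj; rewrite ?inE // fa f1.
  (* Preimages of 0, ..., 4 under a surjection onto [I_5]: two serve as bounds and three are atoms,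
     so any atom a has at least two of these three distinct from it. *)
  have [x0 _ g0] := gsurj 0 isT; have [x1 _ g1] := gsurj 1 isT.
  have [x2 _ g2] := gsurj 2 isT; have [x3 _ g3] := gsurj 3 isT.
  have [x4 _ g4] := gsurj 4 isT.
  have ne (u v : {classic K}) : g u != g v -> u != v by apply: contra_neq => ->.
  have bt : x0 != x1 :> {classic K} by apply: ne; rewrite g0 g1.
  exists x0, x1, bt => a Aa.
  have [] : [/\ atom K x0 x1 bt x2, atom K x0 x1 bt x3 & atom K x0 x1 bt x4].
    by split; apply/andP; split; apply: ne; rewrite ?g0 ?g1 ?g2 ?g3 ?g4.
  have [a2|a2] := eqVneq a x2.
    by exists x3, x4; split=> //; rewrite ?a2; apply: ne; rewrite ?g2 ?g3 ?g4.
  have [a3|a3] := eqVneq a x3.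
    by exists x2, x4; split=> //; rewrite ?a3; apply: ne; rewrite ?g2 ?g3 ?g4.
  by exists x2, x3; split=> //; apply: ne; rewrite g2 g3.
exists flat_display, (flat_lattice K bot top bt), [set p | p.1 = p.2].
split; [by exists bot|exact: flat_lattice_diagonal|exact: card_quotient_diagonal].
Qed.
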